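(* Let $(r_k)_{k\in\mathbb{N}_0}$ be an increasing sequence of real numbers with $0 < r_k < 2^{k-10}$ for all $k\in\mathbb{N}_0$, and let $(w_k)_{k\in\mathbb{N}_0}$ be a sequence of positive numbers. Suppose that $$\sup_{k\in\mathbb{N}}\ \sum_{n=[\log_2 r_k]}^k \frac{1}{w_n^{2}} < \infty.$$ Then there exists a constant $C$, depending only on the sequences $(w_k)$ and $(r_k)$, such that for every sequence of complex numbers $(a_k)_{k\in\mathbb{N}_0}$ with $$\sum_{k=0}^\infty |a_k|^2 w_k^2 < \infty$$ there exists a function $f\in C(\mathbb{T})$ such that $\hat{f}(2^k)=a_k$ for all $k\in\mathbb{N}_0$, $$\hat{f}(n) = 0 \quad\text{for all integers } n\notin \bigcup_{k\ge 0} [2^k-r_k, 2^k+r_k],$$ and $$\|f\|_{C(\mathbb{T})} \le C\sqrt{\sum_{k=0}^\infty |a_k|^2 w_k^2}.$$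
   Context: $\mathbb{N}_0=\{0,1,2,\dots\}$ and $\mathbb{N}=\{1,2,\dots\}$. $\mathbb{T}$ is the unit circle, viewed as the interval $[-\frac12,\frac12]$ with endpoints identified, equipped with Lebesgue probability measure. $C(\mathbb{T})$ is the space of continuous complex-valued functions on $\mathbb{T}$ with the supremum norm $\|\cdot\|_{C(\mathbb{T})}$. For an integrable $f$ on $\mathbb{T}$ and $n\in\mathbb{Z}$, the Fourier coefficients are $\hat f(n)=\int_{-1/2}^{1/2} f(t)e^{-2\pi i n t}\,dt$. $[x]$ denotes the greatest integer not exceeding $x$. Convention: $w_k=\infty$ for $k<0$, i.e. terms $1/w_n^2$ with $n<0$ are equal to $0$. *)

(* Defs.v *)
From Stdlib Require Import Reals ZArith List.
From Coquelicot Require Import Coquelicot.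
Open Scope R_scope.

(* The circle is R/Z: functions on it are 1-periodic functions on R. *)
Definition C_circle (f : R -> C) : Prop :=
  (forall t : R, continuous f t) /\ (forall t : R, f (t + 1) = f t).

Definition sup_norm (f : R -> C) : Rbar :=
  Lub_Rbar (fun y : R => exists t : R, y = Cmod (f t)).

(* exp (i x) *)
Definition cexpi (x : R) : C := (cos x, sin x).

Definition fourier_coeff (f : R -> C) (n : Z) : C :=
  RInt (V := C_R_CompleteNormedModule)
    (fun t : R => Cmult (f t) (cexpi (- (2 * PI * IZR n * t)))) (- (1 / 2)) (1 / 2).

Definition log2 (x : R) : R := ln x / ln 2.

(* The sum of g n over the integers a <= n <= b; it is 0 when b < a. *)
Definition sum_Z (g : Z -> R) (a b : Z) : R :=
  fold_right Rplus 0
    (map (fun i : nat => g (a + Z.of_nat i)%Z) (seq 0 (Z.to_nat (b - a + 1)))).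

(* 1 / w_n ^ 2 with w extended to the integers by w_n = infinity for n < 0. *)
Definition inv_sq_ext (w : nat -> R) (n : Z) : R :=
  if (n <? 0)%Z then 0 else 1 / (w (Z.to_nat n)) ^ 2.

(* Main.v *)
Require Import Defs.
From Stdlib Require Import Reals ZArith Lra Lia IndefiniteDescription.
From Coquelicot Require Import Coquelicot.
Open Scope R_scope.

(** Why the theorem holds.

    The nonnegative integers are cut into consecutive intervals, the epochs: a
    new epoch opens at [k] as soon as [r k] reaches [2 ^ s], where [s] is the
    first element of the current epoch.  This choice balances two demands.
    Inside an epoch, [[log2 (r k)]] lies below every index up to [k], so the
    hypothesis bounds the sum of [1 / w n ^ 2] over the epoch by a constant [M]
    ([epoch_mass]); by Cauchy-Schwarz the polynomial [p i], the sum of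
    [a k * char (2 ^ k)] over the [i]-th epoch, satisfies
    [|p i| <= A i], where the sum of the [A i ^ 2] is at most [M] times the sum
    of [|a k| ^ 2 * w k ^ 2].  And if [j] lies at least two epochs before [k],
    then [2 ^ j <= r k] ([epoch_far]), so that frequencies of size [2 ^ j] may be
    used to correct the term of frequency [2 ^ k].

    The correction is a recursion of Rudin-Shapiro type.  For epochs of a fixed
    parity and a number [s > 0], start from [P = 0], [Q = 1] and replace [(P, Q)]
    by [(P + p i * Q, Q - Cconj (p i) * P / s)].  At each point the quantity
    [|P| ^ 2 + s * |Q| ^ 2] gets multiplied by exactly [1 + |p i| ^ 2 / s]
    ([energy_step]), so [|P| ^ 2] stays below [s * exp M] when [s] bounds the sum
    of [|a k| ^ 2 * w k ^ 2].  The frequencies of [P] are alternating sums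
    [2 ^ k1 - 2 ^ k2 + 2 ^ k3 - ...] over rapidly decreasing indices from
    different epochs.  Such a sum with more than one term lies strictly between
    [2 ^ (k1 - 1)] and [2 ^ k1], within [r k1] of the latter; in particular it is
    not a power of two, and the coefficient of [P] at [2 ^ k] is [a k] as desired
    ([alternating_recursion]).  Adding the functions of the two parities settles
    finitely supported sequences ([extension_finite]).

    The trigonometric polynomials of growing finite sections are bounded but need
    not converge uniformly.  A general sequence is therefore cut into finite
    slices, the [l]-th one having weighted square sum at most [4 ^ (- l)] times
    the total ([geometric_cutoffs]).  The polynomials of the slices decay
    like [2 ^ (- l)] in sup norm, so their sum converges uniformly to the
    required continuous function ([uniform_geometric_sum]). *)

(** * Finite sums *)

(** The sum over [k < n].  The empty sum is allowed, which gives the recursions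
    below their natural starting point, and one definition serves real and
    complex summands. *)
Fixpoint psum {V : AbelianMonoid} (u : nat -> V) (n : nat) : V :=
  match n with
  | O => zero
  | S m => plus (psum u m) (u m)
  end.

Lemma psum_S {V : AbelianMonoid} (u : nat -> V) (n : nat) :
  psum u (S n) = plus (psum u n) (u n).
Proof. reflexivity. Qed.

Lemma psum_ext {V : AbelianMonoid} (u v : nat -> V) (n : nat) :
  (forall k, (k < n)%nat -> u k = v k) -> psum u n = psum v n.
Proof.
  induction n as [|n IH]; intros H; simpl; [reflexivity|].
  rewrite IH by (intros; apply H; lia). rewrite H by lia. reflexivity.
Qed.

Lemma psum_zero {V : AbelianMonoid} (u : nat -> V) (n : nat) :
  (forall k, (k < n)%nat -> u k = zero) -> psum u n = zero.
Proof.
  induction n as [|n IH]; intros H; simpl; [reflexivity|].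
  rewrite IH by (intros; apply H; lia). rewrite H by lia. apply plus_zero_l.
Qed.

Lemma psum_plus {V : AbelianMonoid} (u v : nat -> V) (n : nat) :
  psum (fun k => plus (u k) (v k)) n = plus (psum u n) (psum v n).
Proof.
  induction n as [|n IH]; simpl; [symmetry; apply plus_zero_l|].
  rewrite IH, <- !plus_assoc. f_equal. rewrite !plus_assoc. f_equal.
  apply plus_comm.
Qed.

Lemma psum_single {V : AbelianMonoid} (e : nat) (x : V) (n : nat) :
  (e < n)%nat -> psum (fun i => if Nat.eqb e i then x else zero) n = x.
Proof.
  induction n as [|n IH]; intros H; [lia|]. simpl.
  destruct (Nat.eqb_spec e n) as [->|He].
  - rewrite psum_zero; [apply plus_zero_l|].
    intros k Hk. destruct (Nat.eqb_spec n k); [lia|reflexivity].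
  - rewrite IH by lia. apply plus_zero_r.
Qed.

(** Regroups a sum along the fibres of [e]; applied to the map sending an index
    to its epoch. *)
Lemma psum_fiberwise {V : AbelianMonoid} (e : nat -> nat) (u : nat -> V)
    (n m : nat) :
  (forall k, (k < n)%nat -> (e k < m)%nat) ->
  psum (fun i => psum (fun k => if Nat.eqb (e k) i then u k else zero) n) m
  = psum u n.
Proof.
  induction n as [|n IH]; intros H; simpl.
  - apply psum_zero. reflexivity.
  - rewrite psum_plus, IH by (intros; apply H; lia). f_equal.
    apply psum_single. apply H. lia.
Qed.

Lemma psum_le (u v : nat -> R) (n : nat) :
  (forall k, (k < n)%nat -> u k <= v k) -> psum u n <= psum v n.
Proof.
  induction n as [|n IH]; intros H; simpl; [apply Rle_refl|].
  apply Rplus_le_compat; [apply IH; intros; apply H; lia | apply H; lia].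
Qed.

Lemma psum_pos (u : nat -> R) (n : nat) :
  (forall k, 0 <= u k) -> 0 <= psum u n.
Proof.
  intros H. induction n as [|n IH]; simpl; [apply Rle_refl|].
  apply Rplus_le_le_0_compat; auto.
Qed.

Lemma psum_scal (c : R) (u : nat -> R) (n : nat) :
  psum (fun k => c * u k) n = c * psum u n.
Proof.
  induction n as [|n IH]; simpl.
  - unfold zero; simpl. ring.
  - rewrite IH. unfold plus; simpl. ring.
Qed.

(** Cauchy-Schwarz without square roots: the inductive step is the inequality
    between the arithmetic and geometric means of [psum y n * z n] and
    [psum z n * y n]. *)
Lemma psum_Cauchy_Schwarz (x y z : nat -> R) (n : nat) :
  (forall k, 0 <= x k /\ 0 <= y k /\ 0 <= z k /\ x k ^ 2 <= y k * z k) ->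
  psum x n ^ 2 <= psum y n * psum z n.
Proof.
  intros H. induction n as [|n IH]; simpl psum.
  - unfold zero; simpl. lra.
  - unfold plus; simpl plus.
    destruct (H n) as (Hx & Hy & Hz & Hxyz).
    assert (HX := psum_pos x n (fun k => proj1 (H k))).
    assert (HY := psum_pos y n (fun k => proj1 (proj2 (H k)))).
    assert (HZ := psum_pos z n (fun k => proj1 (proj2 (proj2 (H k))))).
    set (X := psum x n) in *. set (Y := psum y n) in *. set (Z := psum z n) in *.
    change (@psum R_AbelianMonoid x n) with X.
    assert (2 * X * x n <= Y * z n + Z * y n).
    { apply Rsqr_incr_0; [|nra|nra]. unfold Rsqr.
      assert (X ^ 2 * x n ^ 2 <= (Y * Z) * (y n * z n))
        by (apply Rmult_le_compat; auto using pow2_ge_0).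
      assert (0 <= (Y * z n - Z * y n) ^ 2) by apply pow2_ge_0. nra. }
    change ((X + x n) ^ 2 <= (Y + y n) * (Z + z n)). nra.
Qed.

Lemma Cmod_psum (u : nat -> C) (v : nat -> R) (n : nat) :
  (forall k, Cmod (u k) <= v k) -> Cmod (psum u n) <= psum v n.
Proof.
  intros H. induction n as [|n IH]; simpl.
  - unfold zero; simpl. rewrite Cmod_0. apply Rle_refl.
  - eapply Rle_trans; [apply Cmod_triangle|].
    apply Rplus_le_compat; auto.
Qed.

(** * Trigonometric polynomials with prescribed spectrum *)

Definition char (n : Z) (t : R) : C := cexpi (2 * PI * IZR n * t).

Lemma cexpi_plus (x y : R) : cexpi (x + y) = (cexpi x * cexpi y)%C.
Proof.
  unfold cexpi, Cmult; simpl. rewrite cos_plus, sin_plus. f_equal; ring.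
Qed.

Lemma char_plus (m n : Z) (t : R) : char (m + n) t = (char m t * char n t)%C.
Proof.
  unfold char. rewrite <- cexpi_plus, plus_IZR. f_equal. ring.
Qed.

Lemma char_opp (n : Z) (t : R) : char (- n) t = Cconj (char n t).
Proof.
  unfold char, cexpi, Cconj; simpl. rewrite opp_IZR.
  replace (2 * PI * - IZR n * t) with (- (2 * PI * IZR n * t)) by ring.
  rewrite cos_neg, sin_neg. reflexivity.
Qed.

Lemma char_0 (t : R) : char 0 t = RtoC 1.
Proof.
  unfold char, cexpi. rewrite Rmult_0_r, Rmult_0_l, cos_0, sin_0. reflexivity.
Qed.

Lemma Cmod_char (n : Z) (t : R) : Cmod (char n t) = 1.
Proof.
  unfold char, cexpi, Cmod; cbn [fst snd].
  rewrite Rplus_comm, <- !Rsqr_pow2, sin2_cos2. apply sqrt_1.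
Qed.

Lemma sin_IZR_PI (n : Z) : sin (IZR n * PI) = 0.
Proof. apply sin_eq_0_1. now exists n. Qed.

Lemma char_periodic (n : Z) (t : R) : char n (t + 1) = char n t.
Proof.
  unfold char. rewrite Rmult_plus_distr_l, cexpi_plus.
  replace (cexpi (2 * PI * IZR n * 1)) with (RtoC 1); [ring|].
  replace (2 * PI * IZR n * 1) with (2 * (IZR n * PI)) by ring.
  unfold cexpi. rewrite cos_2a_sin, sin_2a, sin_IZR_PI.
  unfold RtoC. f_equal; ring.
Qed.

(** Only the set containing the frequencies is recorded, not the coefficients:
    the spectral claims about the recursion need just the behaviour of these
    sets under sums, products and conjugation.  Both constructors speak of
    functions up to pointwise equality. *)
Inductive trig (S : Z -> Prop) : (R -> C) -> Prop :=
| trig_zero (f : R -> C) : (forall t, f t = RtoC 0) -> trig S f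
| trig_cons c n (f g : R -> C) : S n -> trig S f ->
    (forall t, g t = (c * char n t + f t)%C) -> trig S g.

Lemma trig_ext (S : Z -> Prop) (f g : R -> C) :
  trig S f -> (forall t, g t = f t) -> trig S g.
Proof.
  intros [f' Hf|c n f' f'' Hn Hf' Hf] E.
  - apply trig_zero. intros t. rewrite E. apply Hf.
  - apply (trig_cons S c n f' g Hn Hf'). intros t. rewrite E. apply Hf.
Qed.

Lemma trig_mono (S T : Z -> Prop) (f : R -> C) :
  (forall n, S n -> T n) -> trig S f -> trig T f.
Proof.
  intros H. induction 1 as [f Hf|c n f g Hn _ IH Hg].
  - now apply trig_zero.
  - apply (trig_cons T c n f g); auto.
Qed.

Lemma trig_monomial (S : Z -> Prop) (c : C) (n : Z) :
  S n -> trig S (fun t => (c * char n t)%C).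
Proof.
  intros Hn. apply (trig_cons S c n (fun _ => RtoC 0)); auto.
  - now apply trig_zero.
  - intros t. ring.
Qed.

Lemma trig_plus (S : Z -> Prop) (f g : R -> C) :
  trig S f -> trig S g -> trig S (fun t => (f t + g t)%C).
Proof.
  intros Hf Hg. induction Hf as [f Hf|c n f f' Hn _ IH Hf'].
  - apply (trig_ext S g); auto. intros t. rewrite Hf. ring.
  - apply (trig_cons S c n (fun t => (f t + g t)%C)); auto.
    intros t. rewrite Hf'. ring.
Qed.

Lemma trig_mult (S T U : Z -> Prop) (f g : R -> C) :
  (forall m n, S m -> T n -> U (m + n)%Z) ->
  trig S f -> trig T g -> trig U (fun t => (f t * g t)%C).
Proof.
  intros H Hf Hg. induction Hf as [f Hf|c m f f' Hm _ IHf Hf'].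
  - apply trig_zero. intros t. rewrite Hf. ring.
  - apply (trig_ext U (fun t => (c * char m t * g t + f t * g t)%C)).
    + apply trig_plus; [|exact IHf].
      clear f f' IHf Hf'. induction Hg as [g Hg|d n g g' Hn _ IHg Hg'].
      * apply trig_zero. intros t. rewrite Hg. ring.
      * apply (trig_cons U (c * d) (m + n) (fun t => (c * char m t * g t)%C)); auto.
        intros t. rewrite Hg', char_plus. ring.
    + intros t. rewrite Hf'. ring.
Qed.

Lemma trig_scal (S : Z -> Prop) (c : C) (f : R -> C) :
  trig S f -> trig S (fun t => (c * f t)%C).
Proof.
  induction 1 as [f Hf|d n f g Hn _ IH Hg].
  - apply trig_zero. intros t. rewrite Hf. ring.
  - apply (trig_cons S (c * d) n (fun t => (c * f t)%C)); auto.
    intros t. rewrite Hg. ring.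
Qed.

Lemma trig_conj (S T : Z -> Prop) (f : R -> C) :
  (forall n, S n -> T (- n)%Z) ->
  trig S f -> trig T (fun t => Cconj (f t)).
Proof.
  intros H. induction 1 as [f Hf|c n f g Hn _ IH Hg].
  - apply trig_zero. intros t. rewrite Hf.
    unfold Cconj; simpl. rewrite Ropp_0. reflexivity.
  - apply (trig_cons T (Cconj c) (- n) (fun t => Cconj (f t))); auto.
    intros t. rewrite Hg, Cplus_conj, Cmult_conj, char_opp. reflexivity.
Qed.

Lemma trig_psum (S : Z -> Prop) (u : nat -> R -> C) (n : nat) :
  (forall k, (k < n)%nat -> trig S (u k)) ->
  trig S (fun t => psum (fun k => u k t) n).
Proof.
  induction n as [|n IH]; intros H; simpl.
  - now apply trig_zero.
  - apply (trig_plus S (fun t => psum (fun k => u k t) n)); auto.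
Qed.

Lemma continuous_C (f : R -> C) (t : R) :
  continuous f t <->
  continuous (fun x => fst (f x)) t /\ continuous (fun x => snd (f x)) t.
Proof.
  split.
  - intros H. split.
    + apply (continuous_comp f (fun z : C => fst z)); [exact H|].
      apply continuous_fst.
    + apply (continuous_comp f (fun z : C => snd z)); [exact H|].
      apply continuous_snd.
  - intros [H1 H2].
    apply filterlim_locally. intros eps.
    apply filterlim_locally with (eps := eps) in H1, H2.
    exact (filter_and _ _ H1 H2).
Qed.

Lemma continuous_Cplus (f g : R -> C) (t : R) :
  continuous f t -> continuous g t -> continuous (fun x => (f x + g x)%C) t.
Proof.
  intros Hf Hg. apply continuous_C in Hf, Hg. apply continuous_C. simpl.
  split.
  - now apply (continuous_plus (fun x => fst (f x)) (fun x => fst (g x))).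
  - now apply (continuous_plus (fun x => snd (f x)) (fun x => snd (g x))).
Qed.

Lemma continuous_Cmult (f g : R -> C) (t : R) :
  continuous f t -> continuous g t -> continuous (fun x => (f x * g x)%C) t.
Proof.
  intros Hf Hg. apply continuous_C in Hf, Hg. apply continuous_C. simpl.
  split.
  - apply (continuous_minus (fun x => fst (f x) * fst (g x))
      (fun x => snd (f x) * snd (g x))).
    + now apply (continuous_mult (fun x => fst (f x)) (fun x => fst (g x))).
    + now apply (continuous_mult (fun x => snd (f x)) (fun x => snd (g x))).
  - apply (continuous_plus (fun x => fst (f x) * snd (g x))
      (fun x => snd (f x) * fst (g x))).
    + now apply (continuous_mult (fun x => fst (f x)) (fun x => snd (g x))).
    + now apply (continuous_mult (fun x => snd (f x)) (fun x => fst (g x))).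
Qed.

Lemma continuous_cexpi (c t : R) : continuous (fun x => cexpi (c * x)) t.
Proof.
  apply continuous_C. simpl. split.
  - apply (continuous_comp (fun x => c * x) cos).
    + apply (ex_derive_continuous (fun x => c * x)). auto_derive. trivial.
    + apply continuous_cos.
  - apply (continuous_comp (fun x => c * x) sin).
    + apply (ex_derive_continuous (fun x => c * x)). auto_derive. trivial.
    + apply continuous_sin.
Qed.

Lemma trig_C_circle (S : Z -> Prop) (f : R -> C) : trig S f -> C_circle f.
Proof.
  induction 1 as [f Hf|c n f g Hn _ [IHc IHp] Hg].
  - split; intros t.
    + apply (continuous_ext (fun _ => RtoC 0)); [easy|apply continuous_const].
    + now rewrite !Hf.
  - split; intros t.
    + apply (continuous_ext (fun t => (c * char n t + f t)%C)); [easy|].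
      apply continuous_Cplus; [|apply IHc].
      apply continuous_Cmult; [apply continuous_const|apply continuous_cexpi].
    + now rewrite !Hg, IHp, char_periodic.
Qed.

Lemma C_circle_plus (f g : R -> C) :
  C_circle f -> C_circle g -> C_circle (fun t => (f t + g t)%C).
Proof.
  intros [Hf Pf] [Hg Pg]. split; intros t.
  - now apply continuous_Cplus.
  - now rewrite Pf, Pg.
Qed.

(** * Fourier coefficients *)

Lemma is_RInt_fourier (f : R -> C) (n : Z) :
  C_circle f ->
  is_RInt (V := C_R_NormedModule)
    (fun t : R => Cmult (f t) (cexpi (- (2 * PI * IZR n * t)))) (- (1 / 2)) (1 / 2)
    (fourier_coeff f n).
Proof.
  intros [Hf _]. apply (RInt_correct (V := C_R_CompleteNormedModule)).
  apply (ex_RInt_continuous (V := C_R_CompleteNormedModule)). intros t _.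
  apply (continuous_Cmult f _ t (Hf t)).
  apply (continuous_ext (fun x => cexpi (- (2 * PI * IZR n) * x))).
  - intros x. f_equal. ring.
  - apply continuous_cexpi.
Qed.

Lemma fourier_coeff_ext (f g : R -> C) (n : Z) :
  (forall t, f t = g t) -> fourier_coeff f n = fourier_coeff g n.
Proof.
  intros H. apply (RInt_ext (V := C_R_CompleteNormedModule)).
  intros t _. now rewrite H.
Qed.

Lemma fourier_coeff_plus (f g : R -> C) (n : Z) :
  C_circle f -> C_circle g ->
  fourier_coeff (fun t => (f t + g t)%C) n
  = (fourier_coeff f n + fourier_coeff g n)%C.
Proof.
  intros Hf Hg. apply (is_RInt_unique (V := C_R_CompleteNormedModule)).
  assert (H := is_RInt_plus (V := C_R_NormedModule) _ _ _ _ _ _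
    (is_RInt_fourier f n Hf) (is_RInt_fourier g n Hg)).
  revert H. apply is_RInt_ext. intros t _.
  change plus with Cplus. simpl. unfold Cplus, Cmult; simpl. f_equal; ring.
Qed.

Lemma is_RInt_cos_IZR (q : Z) : (q <> 0)%Z ->
  is_RInt (fun t => cos (2 * PI * IZR q * t)) (- (1 / 2)) (1 / 2) 0.
Proof.
  intros Hq. assert (IZR q <> 0) by now apply not_0_IZR.
  assert (HPI := PI_neq0).
  pose (F := fun t => sin (2 * PI * IZR q * t) / (2 * PI * IZR q)).
  replace 0 with (minus (F (1 / 2)) (F (- (1 / 2)))).
  - apply (is_RInt_derive F).
    + intros t _. unfold F. auto_derive; [easy|]. field; auto.
    + intros t _. apply (ex_derive_continuous (fun t => cos (2 * PI * IZR q * t))).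
      auto_derive. trivial.
  - unfold F, minus, plus, opp; simpl.
    replace (2 * PI * IZR q * (1 / 2)) with (IZR q * PI) by field.
    replace (2 * PI * IZR q * - (1 / 2)) with (- (IZR q * PI)) by field.
    rewrite sin_neg, sin_IZR_PI. field; auto.
Qed.

Lemma is_RInt_sin_IZR (q : Z) : (q <> 0)%Z ->
  is_RInt (fun t => sin (2 * PI * IZR q * t)) (- (1 / 2)) (1 / 2) 0.
Proof.
  intros Hq. assert (IZR q <> 0) by now apply not_0_IZR.
  assert (HPI := PI_neq0).
  pose (F := fun t => - cos (2 * PI * IZR q * t) / (2 * PI * IZR q)).
  replace 0 with (minus (F (1 / 2)) (F (- (1 / 2)))).
  - apply (is_RInt_derive F).
    + intros t _. unfold F. auto_derive; [easy|]. field; auto.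
    + intros t _. apply (ex_derive_continuous (fun t => sin (2 * PI * IZR q * t))).
      auto_derive. trivial.
  - unfold F, minus, plus, opp; simpl.
    replace (2 * PI * IZR q * - (1 / 2)) with (- (2 * PI * IZR q * (1 / 2))) by field.
    rewrite cos_neg. field; auto.
Qed.

Lemma is_RInt_char (c : C) (q : Z) :
  is_RInt (V := C_R_NormedModule)
    (fun t => (c * char q t)%C) (- (1 / 2)) (1 / 2)
    (if Z.eqb q 0 then c else RtoC 0).
Proof.
  destruct (Z.eqb_spec q 0) as [->|Hq].
  - apply (is_RInt_ext (fun _ => c)).
    + intros t _. rewrite char_0. symmetry. apply Cmult_1_r.
    + assert (H := is_RInt_const (V := C_R_NormedModule) (- (1 / 2)) (1 / 2) c).
      refine (eq_ind _ (fun l => is_RInt _ _ _ l) H c _).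
      destruct c as [x y]. unfold scal; simpl. unfold prod_scal, scal; simpl.
      unfold mult; simpl. f_equal; field.
  - destruct c as [x y].
    assert (HC := is_RInt_cos_IZR q Hq). assert (HS := is_RInt_sin_IZR q Hq).
    apply (is_RInt_fct_extend_pair (U := R_NormedModule) (V := R_NormedModule)); simpl.
    + replace 0 with (minus (scal x 0) (scal y 0)).
      * now apply @is_RInt_minus; apply @is_RInt_scal.
      * unfold minus, plus, opp, scal; simpl. unfold mult; simpl. ring.
    + replace 0 with (plus (scal x 0) (scal y 0)).
      * now apply @is_RInt_plus; apply @is_RInt_scal.
      * unfold plus, scal; simpl. unfold mult; simpl. ring.
Qed.

Lemma fourier_coeff_monomial (c : C) (m n : Z) :
  fourier_coeff (fun t => (c * char m t)%C) n = if Z.eqb m n then c else RtoC 0.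
Proof.
  apply (is_RInt_unique (V := C_R_CompleteNormedModule)).
  replace (Z.eqb m n) with (Z.eqb (m - n) 0) by
    (destruct (Z.eqb_spec m n), (Z.eqb_spec (m - n) 0); lia || reflexivity).
  apply (is_RInt_ext (fun t => (c * char (m - n) t)%C)); [|apply is_RInt_char].
  intros t _. unfold Zminus. rewrite char_plus.
  replace (cexpi (- (2 * PI * IZR n * t))) with (char (- n) t).
  - apply Cmult_assoc.
  - unfold char. rewrite opp_IZR. f_equal. ring.
Qed.

Lemma trig_fourier_coeff (S : Z -> Prop) (f : R -> C) (n : Z) :
  trig S f -> ~ S n -> fourier_coeff f n = RtoC 0.
Proof.
  intros Hf Hn. induction Hf as [f Hf|c m f g Hm Hf IH Hg].
  - rewrite (fourier_coeff_ext f (fun t => (0 * char 0 t)%C)).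
    + rewrite fourier_coeff_monomial. now destruct (Z.eqb 0 n).
    + intros t. rewrite Hf. ring.
  - rewrite (fourier_coeff_ext _ _ n Hg).
    rewrite (fourier_coeff_plus (fun t => (c * char m t)%C)).
    + rewrite IH, fourier_coeff_monomial.
      destruct (Z.eqb_spec m n) as [->|]; [contradiction|ring].
    + apply (trig_C_circle (eq m)). now apply trig_monomial.
    + now apply (trig_C_circle S).
Qed.

(** * Uniform limits *)

Lemma Cmod_ball (x y : C) (eps : R) : Cmod (y - x)%C < eps -> ball x eps y.
Proof.
  intros H. assert (HM := Rmax_Cmod (y - x)%C).
  split; eapply Rle_lt_trans; [|exact H| |exact H];
    (eapply Rle_trans; [|exact HM]); [apply Rmax_l|apply Rmax_r].
Qed.

Lemma ball_Cmod (x y : C) (eps : R) : ball x eps y -> Cmod (y - x)%C < 2 * eps.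
Proof.
  intros [H1 H2].
  change (Rabs (fst (y - x)%C) < eps) in H1.
  change (Rabs (snd (y - x)%C) < eps) in H2.
  assert (H0 := Rabs_pos (fst (y - x)%C)).
  unfold Cmod.
  rewrite <- (sqrt_Rsqr (2 * eps)) by lra. apply sqrt_lt_1_alt. split.
  - apply Rplus_le_le_0_compat; apply pow2_ge_0.
  - rewrite <- (pow2_abs (fst _)), <- (pow2_abs (snd _)). unfold Rsqr.
    assert (H0' := Rabs_pos (snd (y - x)%C)). nra.
Qed.

Lemma C_circle_psum (g : nat -> R -> C) (n : nat) :
  (forall l, C_circle (g l)) -> C_circle (fun t => psum (fun l => g l t) n).
Proof.
  intros H. induction n as [|n IH]; simpl.
  - apply (trig_C_circle (fun _ => True)). now apply trig_zero.
  - apply (C_circle_plus (fun t => psum (fun l => g l t) n) (g n)); auto.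
Qed.

Lemma fourier_coeff_psum (g : nat -> R -> C) (n : nat) (m : Z) :
  (forall l, C_circle (g l)) ->
  fourier_coeff (fun t => psum (fun l => g l t) n) m
  = psum (fun l => fourier_coeff (g l) m) n.
Proof.
  intros H. induction n as [|n IH]; simpl.
  - apply (trig_fourier_coeff (fun _ => False)); [now apply trig_zero|easy].
  - rewrite (fourier_coeff_plus (fun t => psum (fun l => g l t) n) (g n)); auto.
    + now rewrite IH.
    + now apply C_circle_psum.
Qed.

(** Keeping the subtracted term [(1 / 2) ^ (n + m)] makes the induction on [m]
    go through. *)
Lemma psum_geometric_tail (u : nat -> C) (D : R) (n m : nat) :
  (forall l, Cmod (u l) <= D * (1 / 2) ^ l) ->
  Cmod (psum u (n + m) - psum u n)%C <= 2 * D * ((1 / 2) ^ n - (1 / 2) ^ (n + m)).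
Proof.
  intros H. induction m as [|m IH].
  - rewrite Nat.add_0_r. unfold Cminus. rewrite Cplus_opp_r, Cmod_0. lra.
  - rewrite Nat.add_succ_r. simpl psum. change (@plus C_AbelianMonoid) with Cplus.
    replace (psum u (n + m) + u (n + m)%nat - psum u n)%C
      with ((psum u (n + m) - psum u n) + u (n + m)%nat)%C by ring.
    eapply Rle_trans; [apply Cmod_triangle|].
    specialize (H (n + m)%nat). simpl pow. lra.
Qed.

(** The partial sums are uniformly Cauchy, and integration against a character
    commutes with uniform limits.  The coefficients are asked to be eventually
    constant along the partial sums since each frequency is met by finitely
    many slices only. *)
Lemma uniform_geometric_sum (g : nat -> R -> C) (D : R) :
  (forall l, C_circle (g l)) ->
  (forall l t, Cmod (g l t) <= D * (1 / 2) ^ l) ->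
  exists f : R -> C, C_circle f /\ (forall t, Cmod (f t) <= 2 * D) /\
    forall (n : Z) (c : C),
      (exists N, forall L, (N <= L)%nat -> psum (fun l => fourier_coeff (g l) n) L = c) ->
      fourier_coeff f n = c.
Proof.
  intros Hc Hg.
  assert (HD : 0 <= D).
  { specialize (Hg 0%nat 0). assert (H := Cmod_ge_0 (g 0%nat 0)). simpl in Hg. lra. }
  pose (F := fun (L : nat) (t : R) => psum (fun l => g l t) L : C).
  assert (HF : forall L, C_circle (F L)) by (intros L; now apply C_circle_psum).
  assert (small : forall eps : posreal, exists N, forall n, (N <= n)%nat ->
            2 * D * (1 / 2) ^ n < eps).
  { intros eps.
    destruct (pow_lt_1_zero (1 / 2) ltac:(rewrite Rabs_pos_eq; lra)
      (eps / (2 * D + 1))) as [N HN].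
    { apply Rdiv_lt_0_compat; [apply eps|lra]. }
    exists N. intros n Hn. specialize (HN n Hn).
    assert (Hp : 0 < (1 / 2) ^ n) by (apply pow_lt; lra).
    rewrite Rabs_pos_eq in HN by lra.
    apply Rlt_div_r in HN; [|lra]. nra. }
  destruct (proj1 (filterlim_locally_cauchy
      (U := @fct_CompleteSpace R C_R_CompleteNormedModule) (F := eventually) F))
    as [f Hf].
  { intros eps. destruct (small eps) as [N HN].
    assert (Hle : forall n m t, (N <= n <= m)%nat -> Cmod (F m t - F n t)%C < eps).
    { intros n m t [Hn Hm]. replace m with (n + (m - n))%nat by lia.
      eapply Rle_lt_trans;
        [apply (psum_geometric_tail (fun l => g l t) D); auto|].
      eapply Rle_lt_trans; [|exact (HN n Hn)].
      assert (0 < (1 / 2) ^ (n + (m - n))) by (apply pow_lt; lra). nra. }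
    exists (fun n => (N <= n)%nat). split; [now exists N|].
    intros n m Hn Hm t. apply Cmod_ball. destruct (Nat.le_ge_cases n m).
    - apply Hle. lia.
    - rewrite <- Cmod_opp, Copp_minus_distr. apply Hle. lia. }
  change (R -> C) in f.
  assert (Hunif : forall eps : posreal, exists N, forall n, (N <= n)%nat ->
            forall t, Cmod (F n t - f t)%C < eps).
  { intros eps.
    destruct (proj1 (filterlim_locally (U := @fct_UniformSpace R C_UniformSpace) F f) Hf
      (pos_div_2 eps)) as [N HN].
    exists N. intros n Hn t. specialize (HN n Hn t). apply ball_Cmod in HN.
    simpl in HN. replace (pos eps) with (2 * (eps / 2)) by field. exact HN. }
  assert (Hpt : forall t, filterlim (fun n => F n t) eventually
            (locally (T := C_UniformSpace) (f t))).
  { intros t. apply filterlim_locally. intros eps. destruct (Hunif eps) as [N HN].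
    exists N. intros n Hn. apply Cmod_ball. auto. }
  exists f. split; [split|split].
  - intros t. apply (filterlim_switch_1 (U := C_UniformSpace) eventually _ (locally t) _
      F f (fun n => F n t) (f t)); auto.
    intros n. apply (proj1 (HF n)).
  - intros t. apply (filterlim_locally_unique (V := C_R_NormedModule) (F := eventually)
      (fun n => F n t)); [|apply Hpt].
    apply (filterlim_ext (fun n => F n (t + 1))); [|apply Hpt].
    intros n. apply (proj2 (HF n)).
  - intros t. apply le_epsilon. intros eps Heps.
    destruct (Hunif (mkposreal eps Heps)) as [N HN].
    specialize (HN N (Nat.le_refl N) t). simpl in HN.
    assert (H := psum_geometric_tail (fun l => g l t) D 0 N (fun l => Hg l t)).
    simpl in H. change (psum (fun l => g l t) N) with (F N t) in H.
    replace (f t) with ((F N t - RtoC 0) + - (F N t - f t))%C by ring.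
    eapply Rle_trans; [apply Cmod_triangle|]. rewrite Cmod_opp.
    assert (0 < (1 / 2) ^ N) by (apply pow_lt; lra).
    change zero with (RtoC 0) in H. nra.
  - intros n c [N HN].
    destruct (filterlim_RInt (V := C_R_CompleteNormedModule)
      (fun L t => Cmult (F L t) (cexpi (- (2 * PI * IZR n * t))))
      (- (1 / 2)) (1 / 2) eventually eventually_filter
      (fun t => Cmult (f t) (cexpi (- (2 * PI * IZR n * t))))
      (fun L => fourier_coeff (F L) n)) as [I [HI1 HI2]].
    + intros L. apply is_RInt_fourier. apply HF.
    + apply (filterlim_locally (U := @fct_UniformSpace R C_UniformSpace)).
      intros eps. destruct (Hunif eps) as [N' HN'].
      exists N'. intros L HL t. apply Cmod_ball.
      replace (F L t * cexpi (- (2 * PI * IZR n * t))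
               - f t * cexpi (- (2 * PI * IZR n * t)))%C
        with ((F L t - f t) * char (- n) t)%C.
      * rewrite Cmod_mult, Cmod_char, Rmult_1_r. auto.
      * unfold char. rewrite opp_IZR.
        replace (2 * PI * - IZR n * t) with (- (2 * PI * IZR n * t)) by ring. ring.
    + transitivity I; [now apply (is_RInt_unique (V := C_R_CompleteNormedModule))|].
      apply (filterlim_locally_unique (V := C_R_NormedModule) (F := eventually)
        (fun L => fourier_coeff (F L) n)); [exact HI1|].
      apply (filterlim_ext_loc (fun _ => c)); [|apply filterlim_const].
      exists N. intros L HL. unfold F. rewrite fourier_coeff_psum; auto.
      symmetry. now apply HN.
Qed.

(** * Epochs *)

(** The pair (number, first element) of the epoch of [k]. *)
Fixpoint epoch_state (r : nat -> R) (k : nat) : nat * nat :=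
  match k with
  | O => (O, O)
  | S k' => let (e, s) := epoch_state r k' in
            if Rle_dec (2 ^ s) (r k) then (S e, k) else (e, s)
  end.

Definition epoch (r : nat -> R) (k : nat) : nat := fst (epoch_state r k).

(** The invariant of the recursion.  Its last clause carries [epoch_far]: if
    [j] is two epochs back, then [j] precedes the first element [s] of the
    previous epoch, and the present epoch was opened because [r] had reached
    [2 ^ s]. *)
Lemma epoch_state_spec (r : nat -> R) (k : nat) :
  (forall i j : nat, (i <= j)%nat -> r i <= r j) ->
  let e := fst (epoch_state r k) in
  let s := snd (epoch_state r k) in
  (e <= k)%nat /\ (s <= k)%nat /\ (s = k \/ r k < 2 ^ s) /\
  forall j, (j <= k)%nat ->
    (epoch r j <= e)%nat /\ (epoch r j = e -> (s <= j)%nat) /\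
    (epoch r j < e -> (j < s)%nat)%nat /\ ((epoch r j + 2 <= e)%nat -> 2 ^ j <= r k).
Proof.
  intros Hr. induction k as [|k IH]; simpl.
  - split; [lia|split; [lia|split; [now left|]]].
    intros j Hj. replace j with 0%nat by lia. unfold epoch; simpl. repeat split; lia.
  - unfold epoch. simpl.
    destruct (epoch_state r k) as [e s] eqn:E. simpl in IH.
    destruct IH as (He & Hs & Hsk & IH).
    assert (Hself : epoch_state r (S k) =
      if Rle_dec (2 ^ s) (r (S k)) then (S e, S k) else (e, s))
      by (simpl; now rewrite E).
    destruct (Rle_dec (2 ^ s) (r (S k))) as [Hle|Hlt]; simpl.
    + split; [lia|split; [lia|split; [now left|]]].
      intros j Hj. destruct (Nat.eq_dec j (S k)) as [->|Hne].
      * rewrite Hself. simpl. repeat split; lia.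
      * destruct (IH j ltac:(lia)) as (H1 & H2 & H3 & H4). unfold epoch in *.
        repeat split; try lia. intros H5.
        eapply Rle_trans; [|exact Hle]. apply Rle_pow; [lra|].
        apply Nat.lt_le_incl, H3. lia.
    + apply Rnot_le_lt in Hlt.
      split; [lia|split; [lia|split; [now right|]]].
      intros j Hj. destruct (Nat.eq_dec j (S k)) as [->|Hne].
      * rewrite Hself. simpl. repeat split; lia.
      * destruct (IH j ltac:(lia)) as (H1 & H2 & H3 & H4). unfold epoch in *.
        repeat split; auto. intros H5.
        eapply Rle_trans; [apply H4; lia|]. apply Hr. lia.
Qed.

Lemma epoch_le (r : nat -> R) (k : nat) :
  (forall i j : nat, (i <= j)%nat -> r i <= r j) -> (epoch r k <= k)%nat.
Proof. intros Hr. apply (epoch_state_spec r k Hr). Qed.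

Lemma epoch_far (r : nat -> R) (j k : nat) :
  (forall i j : nat, (i <= j)%nat -> r i <= r j) ->
  (epoch r j + 2 <= epoch r k)%nat -> 2 ^ j <= r k.
Proof.
  intros Hr H. destruct (Nat.le_gt_cases j k) as [Hjk|Hkj].
  - now apply (epoch_state_spec r k Hr).
  - destruct (epoch_state_spec r j Hr) as (_ & _ & _ & Hs).
    specialize (Hs k ltac:(lia)). unfold epoch in *. lia.
Qed.

(** No epoch was opened after [j] and up to [k], so [r k] is still below
    [2 ^ s], where the first element [s] of the epoch satisfies [s <= j]. *)
Lemma epoch_same (r : nat -> R) (j k : nat) :
  (forall i j : nat, (i <= j)%nat -> r i <= r j) ->
  (j < k)%nat -> epoch r j = epoch r k -> r k < 2 ^ j.
Proof.
  intros Hr Hjk H. destruct (epoch_state_spec r k Hr) as (_ & _ & Hk & Hs).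
  destruct (Hs j ltac:(lia)) as (_ & Hsj & _ & _). specialize (Hsj H).
  destruct Hk as [Hk|Hk]; [lia|].
  eapply Rlt_le_trans; [exact Hk|]. apply Rle_pow; [lra|exact Hsj].
Qed.

Lemma sum_Z_succ (g : Z -> R) (a b : Z) :
  (a <= b + 1)%Z -> sum_Z g a (b + 1) = sum_Z g a b + g (b + 1)%Z.
Proof.
  intros H. unfold sum_Z.
  replace (Z.to_nat (b + 1 - a + 1)) with (S (Z.to_nat (b - a + 1))) by lia.
  rewrite List.seq_S, List.map_app, List.fold_right_app. simpl.
  replace (a + Z.of_nat (Z.to_nat (b - a + 1)))%Z with (b + 1)%Z by lia.
  rewrite Rplus_0_r. generalize (g (b + 1)%Z). intros x.
  induction (List.map _ _) as [|y l IH]; simpl; [ring|]. rewrite IH. ring.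
Qed.

Lemma sum_Z_empty (g : Z -> R) (a b : Z) : (b < a)%Z -> sum_Z g a b = 0.
Proof.
  intros H. unfold sum_Z. now replace (Z.to_nat (b - a + 1)) with O by lia.
Qed.

Lemma sum_Z_pos (g : Z -> R) (a b : Z) : (forall n, 0 <= g n) -> 0 <= sum_Z g a b.
Proof.
  intros H. unfold sum_Z. induction (List.seq _ _) as [|i l IH]; simpl; [lra|].
  specialize (H (a + Z.of_nat i)%Z). lra.
Qed.

Lemma psum_le_sum_Z (g : Z -> R) (a : Z) (n : nat) :
  (forall m, 0 <= g m) ->
  psum (fun k => if Z.leb a (Z.of_nat k) then g (Z.of_nat k) else 0) n
  <= sum_Z g a (Z.of_nat n - 1).
Proof.
  intros H. induction n as [|n IH]; simpl psum.
  - now apply sum_Z_pos.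
  - change (@plus R_AbelianMonoid) with Rplus.
    replace (Z.of_nat (S n) - 1)%Z with (Z.of_nat n - 1 + 1)%Z by lia.
    destruct (Z.leb_spec a (Z.of_nat n)).
    + rewrite sum_Z_succ by lia.
      replace (Z.of_nat n - 1 + 1)%Z with (Z.of_nat n) by lia.
      apply Rplus_le_compat_r, IH.
    + rewrite sum_Z_empty in * by lia. rewrite Rplus_0_r. exact IH.
Qed.

Lemma inv_sq_ext_pos (w : nat -> R) (n : Z) :
  (forall k, 0 < w k) -> 0 <= inv_sq_ext w n.
Proof.
  intros Hw. unfold inv_sq_ext. destruct (Z.ltb n 0); [lra|].
  apply Rlt_le, Rdiv_lt_0_compat; [lra|]. now apply pow_lt.
Qed.

Lemma Zfloor_log2_lt (x : R) (j : nat) :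
  0 < x -> x < 2 ^ j -> (Zfloor (log2 x) < Z.of_nat j)%Z.
Proof.
  intros Hx H. apply lt_IZR. eapply Rle_lt_trans; [apply Zfloor_bound|].
  rewrite <- INR_IZR_INZ. unfold log2.
  assert (Hln := ln_lt_2).
  apply Rlt_div_l; [lra|]. rewrite <- ln_pow by lra. now apply ln_increasing.
Qed.

(** If [k] is the last index contributing to the sum, all others are at least
    [[log2 (r k)]] by [epoch_same], so the sum is part of the one that is bounded
    for [k]. *)
Lemma epoch_mass (r w : nat -> R) (M : R) (i n : nat) :
  (forall i j : nat, (i <= j)%nat -> r i <= r j) ->
  (forall k, 0 < r k < 2 ^ k) ->
  (forall k, 0 < w k) ->
  (forall k, sum_Z (inv_sq_ext w) (Zfloor (log2 (r k))) (Z.of_nat k) <= M) ->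
  psum (fun k => if Nat.eqb (epoch r k) i then / w k ^ 2 else 0) n <= M.
Proof.
  intros Hr Hb Hw HM. induction n as [|n IH].
  - eapply Rle_trans; [|exact (HM 0%nat)]. apply sum_Z_pos.
    intros. now apply inv_sq_ext_pos.
  - destruct (Nat.eqb_spec (epoch r n) i) as [Hi|Hi].
    + eapply Rle_trans; [|exact (HM n)].
      replace (Z.of_nat n) with (Z.of_nat (S n) - 1)%Z by lia.
      eapply Rle_trans; [|apply psum_le_sum_Z; intros; now apply inv_sq_ext_pos].
      apply psum_le. intros k Hk.
      assert (Hpos : 0 <= inv_sq_ext w (Z.of_nat k)) by now apply inv_sq_ext_pos.
      destruct (Nat.eqb_spec (epoch r k) i) as [Hik|Hik].
      * assert (Hf : (Zfloor (log2 (r n)) < Z.of_nat k)%Z).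
        { apply Zfloor_log2_lt; [apply Hb|].
          destruct (Nat.eq_dec k n) as [->|Hkn]; [apply Hb|].
          apply (epoch_same r k n Hr); [lia|congruence]. }
        destruct (Z.leb_spec (Zfloor (log2 (r n))) (Z.of_nat k)); [|lia].
        unfold inv_sq_ext. destruct (Z.ltb_spec (Z.of_nat k) 0); [lia|].
        rewrite Nat2Z.id. unfold Rdiv. lra.
      * destruct (Z.leb _ _); lra.
    + simpl psum. change (@plus R_AbelianMonoid) with Rplus.
      destruct (Nat.eqb_spec (epoch r n) i); [contradiction|].
      rewrite Rplus_0_r. exact IH.
Qed.

(** * The alternating recursion *)

(** The cross terms [2 * Re (Cconj P * p * Q)] of the two squares cancel; the
    factor [1 / s] in the second component makes this work for the weighted
    energy. *)
Lemma energy_step (s : R) (P Q p : C) : 0 < s ->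
  Cmod (P + p * Q)%C ^ 2 + s * Cmod (Q + RtoC (- / s) * (Cconj p * P))%C ^ 2
  = (1 + Cmod p ^ 2 / s) * (Cmod P ^ 2 + s * Cmod Q ^ 2).
Proof.
  intros Hs. rewrite !Cmod2_alt.
  destruct P as [P1 P2], Q as [Q1 Q2], p as [p1 p2]. simpl. field. lra.
Qed.

Lemma IZR_pow2 (k : nat) : IZR (2 ^ Z.of_nat k) = 2 ^ k.
Proof. now rewrite <- pow_IZR. Qed.

Lemma exp_monotone (x y : R) : x <= y -> exp x <= exp y.
Proof. intros [H| ->]; [left; now apply exp_increasing|apply Rle_refl]. Qed.

(** The place where the error frequencies live: close to a power of two as
    required, yet strictly between two consecutive powers of two, so that they
    leave the prescribed coefficients untouched. *)
Definition below_pow2 (r : nat -> R) (n : Z) : Prop :=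
  exists k : nat, 2 ^ k - r k <= IZR n /\
    (2 ^ Z.of_nat k < 2 * n)%Z /\ (n < 2 ^ Z.of_nat k)%Z.

(** [B i k] means that the frequency [2 ^ k] may occur in [p i].  The spectra of
    [P] and of [Q - 1] have to be controlled together: each new frequency of one
    is a power [2 ^ k] or [- 2 ^ k] from the current block plus a frequency of
    the other, which in absolute value is at most [2 ^ j] for some [j] in an
    earlier block, hence at most [r k], itself less than half of [2 ^ k]. *)
Lemma alternating_recursion (r : nat -> R) (B : nat -> nat -> Prop)
    (p : nat -> R -> C) (A : nat -> R) (s : R) (n : nat) :
  0 < s ->
  (forall k, 2 * r k < 2 ^ k) ->
  (forall i j i' k, (i < i')%nat -> B i j -> B i' k -> 2 ^ j <= r k) ->
  (forall i, trig (fun m => exists k, B i k /\ m = (2 ^ Z.of_nat k)%Z) (p i)) ->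
  (forall i t, Cmod (p i t) <= A i) ->
  exists P Q : R -> C,
    trig (fun m => exists i k, (i < n)%nat /\ B i k /\ (0 < m <= 2 ^ Z.of_nat k)%Z) P /\
    trig (fun m => exists i k, (i < n)%nat /\ B i k /\ (- 2 ^ Z.of_nat k < m < 0)%Z)
      (fun t => (Q t - RtoC 1)%C) /\
    trig (below_pow2 r) (fun t => (P t - psum (fun i => p i t) n)%C) /\
    (forall t, Cmod (P t) ^ 2 + s * Cmod (Q t) ^ 2
               <= s * exp (psum (fun i => A i ^ 2) n / s)).
Proof.
  intros Hs Hr HB Hp HA. induction n as [|n IH].
  - exists (fun _ => RtoC 0), (fun _ => RtoC 1). repeat split.
    + now apply trig_zero.
    + apply trig_zero. intros t. ring.
    + apply trig_zero. intros t. simpl. change zero with (RtoC 0). ring.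
    + intros t. rewrite Cmod_0, Cmod_1. simpl psum. change zero with 0.
      replace (0 / s) with 0 by (field; lra). rewrite exp_0. lra.
  - destruct IH as (P & Q & HP & HQ & HPp & HE).
    assert (gap : forall i j k, (i < n)%nat -> B i j -> B n k ->
              2 ^ j <= r k /\ (2 * 2 ^ Z.of_nat j < 2 ^ Z.of_nat k)%Z).
    { intros i j k Hi Hj Hk. assert (H := HB i j n k Hi Hj Hk). split; [exact H|].
      apply lt_IZR. rewrite mult_IZR, !IZR_pow2. specialize (Hr k). lra. }
    exists (fun t => (P t + p n t * Q t)%C),
      (fun t => (Q t + RtoC (- / s) * (Cconj (p n t) * P t))%C).
    repeat split.
    (* Splitting off [p n] leaves only the genuinely shifted frequencies in the
       product, as [Q - 1] has no constant term. *)
    + apply (trig_ext _ (fun t => (P t + (p n t + p n t * (Q t - RtoC 1)))%C));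
        [|intros t; ring].
      apply trig_plus; [|apply trig_plus].
      * revert HP. apply trig_mono. intros m (i & k & Hi & H). exists i, k.
        split; [lia|exact H].
      * specialize (Hp n). revert Hp. apply trig_mono. intros m (k & Hk & ->).
        exists n, k. repeat split; auto; lia.
      * revert HQ. apply (trig_mult _ _ _ _ _) with (2 := Hp n).
        intros m m' (k & Hk & ->) (i & j & Hi & Hj & Hm').
        destruct (gap i j k Hi Hj Hk). exists n, k. repeat split; auto; lia.
    + apply (trig_ext _ (fun t => ((Q t - RtoC 1)
               + RtoC (- / s) * (Cconj (p n t) * P t))%C)); [|intros t; ring].
      apply trig_plus.
      * revert HQ. apply trig_mono. intros m (i & k & Hi & H). exists i, k.
        split; [lia|exact H].
      * apply trig_scal. revert HP.
        apply trig_mult with (S := fun m => exists k, B n k /\ m = (- 2 ^ Z.of_nat k)%Z).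
        -- intros m m' (k & Hk & ->) (i & j & Hi & Hj & Hm').
           destruct (gap i j k Hi Hj Hk). exists n, k. repeat split; auto; lia.
        -- specialize (Hp n). revert Hp. apply trig_conj.
           intros m (k & Hk & ->). now exists k.
    + apply (trig_ext _ (fun t => ((P t - psum (fun i => p i t) n)
               + p n t * (Q t - RtoC 1))%C)).
      2:{ intros t. simpl. change (@plus C_AbelianMonoid) with Cplus. ring. }
      apply trig_plus; [exact HPp|].
      revert HQ. apply (trig_mult _ _ _ _ _) with (2 := Hp n).
      intros m m' (k & Hk & ->) (i & j & Hi & Hj & Hm').
      destruct (gap i j k Hi Hj Hk) as [H1 H2]. exists k. repeat split; try lia.
      rewrite plus_IZR, IZR_pow2.
      assert (H3 : IZR (- 2 ^ Z.of_nat j) <= IZR m') by (apply IZR_le; lia).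
      rewrite opp_IZR, IZR_pow2 in H3. lra.
    + intros t. rewrite energy_step by exact Hs.
      assert (HAt : Cmod (p n t) ^ 2 <= A n ^ 2).
      { apply pow_incr. split; [apply Cmod_ge_0|apply HA]. }
      simpl psum. change (@plus R_AbelianMonoid) with Rplus.
      rewrite Rdiv_plus_distr, exp_plus.
      rewrite Rmult_comm, <- Rmult_assoc. apply Rmult_le_compat.
      * apply Rplus_le_le_0_compat; [apply pow2_ge_0|].
        apply Rmult_le_pos; [lra|apply pow2_ge_0].
      * assert (0 <= Cmod (p n t) ^ 2 / s).
        { apply Rmult_le_pos; [apply pow2_ge_0|]. now apply Rlt_le, Rinv_0_lt_compat. }
        lra.
      * apply HE.
      * eapply Rle_trans; [|apply exp_ineq1_le]. apply Rplus_le_compat_l.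
        apply Rmult_le_compat_r; [now apply Rlt_le, Rinv_0_lt_compat|exact HAt].
Qed.

(** * Extension of finite sequences *)

(** Two distinct epochs of the same parity are at least two apart, which is what
    [epoch_far] needs. *)
Lemma extension_one_parity (r w : nat -> R) (M s : R) (par : bool) (b : nat -> C)
    (n : nat) :
  (forall j k : nat, (j <= k)%nat -> r j <= r k) ->
  (forall k, 0 < r k /\ 2 * r k < 2 ^ k) ->
  (forall k, 0 < w k) ->
  (forall k, sum_Z (inv_sq_ext w) (Zfloor (log2 (r k))) (Z.of_nat k) <= M) ->
  (forall k, Nat.even (epoch r k) <> par -> b k = RtoC 0) ->
  0 < s -> psum (fun k => Cmod (b k) ^ 2 * w k ^ 2) n <= s ->
  exists f : R -> C,
    trig (below_pow2 r)
      (fun t => (f t - psum (fun k => b k * char (2 ^ Z.of_nat k) t) n)%C) /\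
    forall t, Cmod (f t) ^ 2 <= s * exp M.
Proof.
  intros Hr Hb Hw HM Hpar Hs Hn.
  set (p := fun (i : nat) (t : R) => psum (fun k => if Nat.eqb (epoch r k) i
    then (b k * char (2 ^ Z.of_nat k) t)%C else zero) n : C).
  set (A := fun i : nat => psum (fun k => if Nat.eqb (epoch r k) i
    then Cmod (b k) else 0) n : R).
  destruct (alternating_recursion r
    (fun i k => epoch r k = i /\ Nat.even i = par) p A s n Hs)
    as (P & Q & _ & _ & HP & HE).
  - intros k. apply Hb.
  - intros i j i' k Hi [Hj Hpi] [Hk Hpi']. apply (epoch_far r j k Hr). rewrite Hj, Hk.
    destruct (Nat.eq_dec i' (S i)) as [->|]; [|lia].
    rewrite Nat.even_succ, <- Nat.negb_even in Hpi'.
    rewrite <- Hpi in Hpi'. now destruct (Nat.even i).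
  - intros i. apply (trig_psum _ (fun k t => if Nat.eqb (epoch r k) i
      then (b k * char (2 ^ Z.of_nat k) t)%C else zero)).
    intros k _. destruct (Nat.eqb_spec (epoch r k) i) as [Hi|Hi];
      [|now apply trig_zero].
    destruct (Bool.bool_dec (Nat.even i) par) as [He|He].
    + apply trig_monomial. exists k. auto.
    + apply trig_zero. intros t. rewrite Hpar; [ring|congruence].
  - intros i t. apply Cmod_psum. intros k.
    destruct (Nat.eqb (epoch r k) i).
    + rewrite Cmod_mult, Cmod_char. lra.
    + change zero with (RtoC 0). rewrite Cmod_0. lra.
  - exists P. split.
    + apply (trig_ext _ _ _ HP).
      intros t. unfold p. rewrite psum_fiberwise; [reflexivity|].
      intros k Hk. assert (H := epoch_le r k Hr). lia.
    + intros t. specialize (HE t).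
      assert (0 <= s * Cmod (Q t) ^ 2)
        by (apply Rmult_le_pos; [lra|apply pow2_ge_0]).
      eapply Rle_trans; [|eapply Rle_trans; [exact HE|]]; [lra|].
      apply Rmult_le_compat_l; [lra|]. apply exp_monotone.
      apply Rle_div_l; [exact Hs|].
      assert (HM0 : 0 <= M).
      { eapply Rle_trans; [|exact (HM 0%nat)]. apply sum_Z_pos.
        intros. now apply inv_sq_ext_pos. }
      eapply Rle_trans; [|apply Rmult_le_compat_l; [exact HM0|exact Hn]].
      rewrite <- (psum_fiberwise (V := R_AbelianMonoid) (epoch r)
        (fun k => Cmod (b k) ^ 2 * w k ^ 2) n n).
      2:{ intros k Hk. assert (H' := epoch_le r k Hr). lia. }
      rewrite <- psum_scal. apply psum_le. intros i _.
      eapply Rle_trans.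
      * apply (psum_Cauchy_Schwarz _
          (fun k => if Nat.eqb (epoch r k) i then / w k ^ 2 else 0)
          (fun k => if Nat.eqb (epoch r k) i then Cmod (b k) ^ 2 * w k ^ 2 else 0)).
        intros k. destruct (Nat.eqb (epoch r k) i); [|repeat split; lra].
        assert (Hw2 : 0 < w k ^ 2) by now apply pow_lt.
        repeat split.
        -- apply Cmod_ge_0.
        -- now apply Rlt_le, Rinv_0_lt_compat.
        -- apply Rmult_le_pos; [apply pow2_ge_0|lra].
        -- apply Req_le. field. apply Rgt_not_eq, Hw.
      * apply Rmult_le_compat_r.
        -- apply psum_pos. intros k. destruct (Nat.eqb (epoch r k) i);
             [|apply Rle_refl].
           apply Rmult_le_pos; apply pow2_ge_0.
        -- apply (epoch_mass r w M i n Hr); auto. intros k.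
           destruct (Hb k). split; [auto|lra].
Qed.

Lemma pow2_not_below_pow2 (r : nat -> R) (k : nat) :
  ~ below_pow2 r (2 ^ Z.of_nat k)%Z.
Proof.
  intros (j & _ & H1 & H2).
  replace (2 * 2 ^ Z.of_nat k)%Z with (2 ^ (Z.of_nat k + 1))%Z in H1
    by (rewrite Z.pow_add_r by lia; ring).
  apply Z.pow_lt_mono_r_iff in H1, H2; lia.
Qed.

Lemma extension_fourier_coeff (r : nat -> R) (a : nat -> C) (n : nat) (f : R -> C) :
  trig (below_pow2 r)
    (fun t => (f t - psum (fun k => a k * char (2 ^ Z.of_nat k) t) n)%C) ->
  (forall k, (n <= k)%nat -> a k = RtoC 0) ->
  C_circle f /\ (forall k, fourier_coeff f (2 ^ Z.of_nat k)%Z = a k) /\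
  (forall m, (forall k, m <> (2 ^ Z.of_nat k)%Z) -> ~ below_pow2 r m ->
    fourier_coeff f m = RtoC 0).
Proof.
  intros Hf Ha.
  set (g := fun t => (f t - psum (fun k => a k * char (2 ^ Z.of_nat k) t) n)%C) in *.
  set (T := fun t => psum (fun k => (a k * char (2 ^ Z.of_nat k) t)%C) n : C).
  assert (Hmono : forall k, C_circle (fun t => (a k * char (2 ^ Z.of_nat k) t)%C)).
  { intros k. apply (trig_C_circle (fun _ => True)). now apply trig_monomial. }
  assert (Hg : C_circle g) by now apply (trig_C_circle (below_pow2 r)).
  assert (HT : C_circle T).
  { apply (C_circle_psum (fun k t => (a k * char (2 ^ Z.of_nat k) t)%C)).
    exact Hmono. }
  assert (Hfg : forall t, f t = (g t + T t)%C).
  { intros t. unfold g. fold (T t). ring. }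
  assert (Hcoeff : forall m, ~ below_pow2 r m -> fourier_coeff f m
    = psum (fun k => if Z.eqb (2 ^ Z.of_nat k) m then a k else RtoC 0) n).
  { intros m Hm.
    rewrite (fourier_coeff_ext _ _ m Hfg), fourier_coeff_plus by assumption.
    rewrite (trig_fourier_coeff (below_pow2 r)) by assumption.
    rewrite Cplus_0_l. unfold T.
    rewrite (fourier_coeff_psum (fun k t => (a k * char (2 ^ Z.of_nat k) t)%C))
      by exact Hmono.
    apply psum_ext. intros k _. apply fourier_coeff_monomial. }
  split; [|split].
  - destruct (C_circle_plus g T Hg HT) as [H1 H2]. split; intros t.
    + apply (continuous_ext (fun t => (g t + T t)%C)); [easy|apply H1].
    + rewrite !Hfg. apply H2.
  - intros k. rewrite Hcoeff by apply pow2_not_below_pow2.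
    rewrite (psum_ext _ (fun j => if Nat.eqb k j then a k else zero)).
    + destruct (Nat.lt_ge_cases k n) as [Hk|Hk]; [now apply psum_single|].
      rewrite psum_zero; [symmetry; now apply Ha|].
      intros j Hj. destruct (Nat.eqb_spec k j); [lia|reflexivity].
    + intros j _. destruct (Nat.eqb_spec k j) as [->|Hkj].
      * now rewrite Z.eqb_refl.
      * destruct (Z.eqb_spec (2 ^ Z.of_nat j) (2 ^ Z.of_nat k)) as [E|]; [|reflexivity].
        apply Z.pow_inj_r in E; lia.
  - intros m Hm Hm'. rewrite Hcoeff by exact Hm'. rewrite psum_zero; [reflexivity|]. intros k _.
    destruct (Z.eqb_spec (2 ^ Z.of_nat k) m) as [E|]; [|reflexivity].
    now destruct (Hm k).
Qed.

Lemma extension_finite (r w : nat -> R) (M s : R) (a : nat -> C) (n : nat) :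
  (forall j k : nat, (j <= k)%nat -> r j <= r k) ->
  (forall k, 0 < r k /\ 2 * r k < 2 ^ k) ->
  (forall k, 0 < w k) ->
  (forall k, sum_Z (inv_sq_ext w) (Zfloor (log2 (r k))) (Z.of_nat k) <= M) ->
  (forall k, (n <= k)%nat -> a k = RtoC 0) ->
  0 < s -> psum (fun k => Cmod (a k) ^ 2 * w k ^ 2) n <= s ->
  exists f : R -> C,
    C_circle f /\ (forall k, fourier_coeff f (2 ^ Z.of_nat k)%Z = a k) /\
    (forall m, (forall k, m <> (2 ^ Z.of_nat k)%Z) -> ~ below_pow2 r m ->
      fourier_coeff f m = RtoC 0) /\
    forall t, Cmod (f t) <= 2 * sqrt (s * exp M).
Proof.
  intros Hr Hb Hw HM Ha Hs Hn.
  set (part := fun (par : bool) (k : nat) =>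
    if Bool.eqb (Nat.even (epoch r k)) par then a k else RtoC 0).
  assert (Hpart : forall par, exists f : R -> C,
    trig (below_pow2 r) (fun t => (f t
      - psum (fun k => part par k * char (2 ^ Z.of_nat k) t) n)%C) /\
    forall t, Cmod (f t) ^ 2 <= s * exp M).
  { intros par. apply (extension_one_parity r w M s par (part par) n); auto.
    - intros k Hk. unfold part. now rewrite (proj2 (Bool.eqb_false_iff _ _) Hk).
    - eapply Rle_trans; [|exact Hn]. apply psum_le. intros k _. unfold part.
      destruct (Bool.eqb _ _); [apply Rle_refl|]. rewrite Cmod_0.
      assert (0 <= Cmod (a k) ^ 2 * w k ^ 2)
        by (apply Rmult_le_pos; apply pow2_ge_0). lra. }
  destruct (Hpart true) as (f & Hf & Bf). destruct (Hpart false) as (g & Hg & Bg).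
  exists (fun t => (f t + g t)%C).
  destruct (extension_fourier_coeff r a n (fun t => (f t + g t)%C)) as (H1 & H2 & H3).
  - apply (trig_ext _ _ _ (trig_plus _ _ _ Hf Hg)). intros t.
    rewrite (psum_ext (fun k => a k * char (2 ^ Z.of_nat k) t)%C
      (fun k => plus (part true k * char (2 ^ Z.of_nat k) t)%C
        (part false k * char (2 ^ Z.of_nat k) t)%C)).
    + rewrite psum_plus. change (@plus C_AbelianMonoid) with Cplus. ring.
    + intros k _. unfold part. change (@plus C_AbelianMonoid) with Cplus.
      destruct (Nat.even (epoch r k)); simpl; ring.
  - exact Ha.
  - repeat split; auto; try apply H1. intros t.
    assert (bound : forall z : C, Cmod z ^ 2 <= s * exp M -> Cmod z <= sqrt (s * exp M)).
    { intros z Hz. rewrite <- (sqrt_pow2 (Cmod z)) by apply Cmod_ge_0.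
      now apply sqrt_le_1_alt. }
    eapply Rle_trans; [apply Cmod_triangle|].
    specialize (bound (f t) (Bf t)) as Hb1. specialize (bound (g t) (Bg t)). lra.
Qed.

(** * Passage to infinite sequences *)

Lemma psum_sum_n (u : nat -> R) (n : nat) : psum u (S n) = sum_n u n.
Proof.
  induction n as [|n IH].
  - rewrite sum_O. apply Rplus_0_l.
  - rewrite sum_Sn, <- IH. reflexivity.
Qed.

Lemma psum_le_Series (u : nat -> R) (n : nat) :
  (forall k, 0 <= u k) -> ex_series u -> psum u n <= Series u.
Proof.
  intros Hu Hs. apply Rle_trans with (psum u (S n)).
  - simpl. specialize (Hu n). change (psum u n <= psum u n + u n). lra.
  - rewrite psum_sum_n. apply (is_lim_seq_incr_compare (sum_n u)).
    + apply (Series_correct _ Hs).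
    + intros m. rewrite sum_Sn. specialize (Hu (S m)).
      change (sum_n u m <= sum_n u m + u (S m)). lra.
Qed.

Lemma psum_split (u : nat -> R) (m n : nat) : (m <= n)%nat ->
  psum (fun k => if Nat.leb m k then u k else 0) n = psum u n - psum u m.
Proof.
  intros H. induction H as [|n H IH].
  - rewrite psum_zero; [symmetry; apply Rminus_diag|].
    intros k Hk. destruct (Nat.leb_spec m k); [lia|reflexivity].
  - rewrite psum_S, IH, psum_S. change (@plus R_AbelianMonoid) with Rplus.
    destruct (Nat.leb_spec m n); [lra|lia].
Qed.

(** The strict monotonicity of [N] ensures that the slices between consecutive
    cutoffs exhaust all indices. *)
Lemma geometric_cutoffs (u : nat -> R) :
  (forall k, 0 <= u k) -> ex_series u -> 0 < Series u ->
  exists N : nat -> nat, N O = O /\ (forall l, (N l < N (S l))%nat) /\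
    forall l, Series u - psum u (N l) <= Series u * (1 / 4) ^ l.
Proof.
  intros Hu Hs H0.
  assert (Hmono : forall m n, (m <= n)%nat -> psum u m <= psum u n).
  { intros m n H. induction H as [|n H IH]; [apply Rle_refl|].
    simpl. specialize (Hu n). change (psum u m <= psum u n + u n). lra. }
  destruct (functional_choice
    (fun l N => Series u - psum u N <= Series u * (1 / 4) ^ l)) as [N0 HN0].
  { intros l. assert (He : 0 < Series u * (1 / 4) ^ l)
      by (apply Rmult_lt_0_compat; [lra|apply pow_lt; lra]).
    assert (Hlim : is_lim_seq (sum_n u) (Series u)) by apply (Series_correct _ Hs).
    apply is_lim_seq_spec in Hlim.
    destruct (Hlim (mkposreal _ He)) as [N HN]. exists (S N).
    specialize (HN N (Nat.le_refl N)). cbn [pos] in HN. apply Rabs_def2 in HN.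
    destruct HN as [_ HN]. rewrite psum_sum_n. lra. }
  pose (N := fix N l := match l with O => O | S l' => Nat.max (S (N l')) (N0 (S l')) end).
  assert (HNS : forall l, N (S l) = Nat.max (S (N l)) (N0 (S l))) by reflexivity.
  exists N. split; [reflexivity|split].
  - intros l. rewrite HNS. lia.
  - intros [|l].
    + simpl. change zero with 0. lra.
    + eapply Rle_trans; [|apply (HN0 (S l))].
      assert (H := Hmono (N0 (S l)) (N (S l)) ltac:(rewrite HNS; lia)). lra.
Qed.

Lemma psum_slices (N : nat -> nat) (x : C) (k L : nat) :
  N O = O -> (forall l, (N l < N (S l))%nat) -> (k < N L)%nat ->
  psum (fun l => if andb (Nat.leb (N l) k) (Nat.ltb k (N (S l))) then x else RtoC 0) L
  = x.
Proof.
  intros HN0 HN.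
  assert (Hall : forall L, psum (fun l =>
      if andb (Nat.leb (N l) k) (Nat.ltb k (N (S l))) then x else RtoC 0) L
      = if Nat.ltb k (N L) then x else RtoC 0).
  { intros L'. induction L' as [|L' IH].
    - rewrite HN0. reflexivity.
    - rewrite psum_S, IH. change (@plus C_AbelianMonoid) with Cplus.
      specialize (HN L').
      destruct (Nat.ltb_spec k (N L')), (Nat.leb_spec (N L') k),
        (Nat.ltb_spec k (N (S L'))); simpl; try lia; ring. }
  intros Hk. rewrite Hall. now apply Nat.ltb_lt in Hk as ->.
Qed.

Lemma sup_norm_le (f : R -> C) (B : R) :
  (forall t, Cmod (f t) <= B) -> Rbar_le (sup_norm f) (Finite B).
Proof.
  intros H. unfold sup_norm. apply Lub_Rbar_correct.
  intros y [t ->]. apply H.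
Qed.

Theorem theorem1p5 :
  forall (r w : nat -> R)
    (r_incr : forall j k : nat, (j <= k)%nat -> r j <= r k)
    (r_bound : forall k : nat, 0 < r k < powerRZ 2 (Z.of_nat k - 10))
    (w_pos : forall k : nat, 0 < w k)
    (* the supremum is over k >= 1, hence the shift by S *)
    (w_sup : Rbar_lt
       (Sup_seq (fun j : nat =>
          Finite (sum_Z (inv_sq_ext w) (Zfloor (log2 (r (S j)))) (Z.of_nat (S j)))))
       p_infty),
  exists K : R,
    forall (a : nat -> C)
      (a_sum : ex_series (fun k : nat => Cmod (a k) ^ 2 * w k ^ 2)),
    exists f : R -> C,
      C_circle f /\
      (forall k : nat, fourier_coeff f (2 ^ Z.of_nat k)%Z = a k) /\
      (forall n : Z,
         ~ (exists k : nat, 2 ^ k - r k <= IZR n <= 2 ^ k + r k) ->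
         fourier_coeff f n = RtoC 0) /\
      Rbar_le (sup_norm f)
        (Finite (K * sqrt (Series (fun k : nat => Cmod (a k) ^ 2 * w k ^ 2)))).
Proof.
  intros r w r_incr r_bound w_pos w_sup.
  assert (Hb : forall k, 0 < r k /\ 2 * r k < 2 ^ k).
  { intros k. destruct (r_bound k) as [H1 H2]. split; [exact H1|].
    unfold Zminus in H2. rewrite powerRZ_add, <- pow_powerRZ in H2 by lra.
    assert (H3 : powerRZ 2 (- (10)) <= 1 / 2) by (simpl; lra).
    assert (0 < 2 ^ k) by (apply pow_lt; lra). nra. }
  assert (Hsup : exists M, forall k,
    sum_Z (inv_sq_ext w) (Zfloor (log2 (r k))) (Z.of_nat k) <= M).
  { set (u := fun j : nat => Finite (sum_Z (inv_sq_ext w)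
      (Zfloor (log2 (r (S j)))) (Z.of_nat (S j)))) in w_sup.
    assert (HS := Sup_seq_correct u).
    destruct (Sup_seq u) as [S| |]; [|easy|].
    (* The supremum starts at [k = 1], so the sum for [k = 0] is added by hand. *)
    - exists (Rmax S (sum_Z (inv_sq_ext w) (Zfloor (log2 (r O))) (Z.of_nat O))).
      intros [|k]; [apply Rmax_r|]. eapply Rle_trans; [|apply Rmax_l].
      apply le_epsilon. intros eps Heps.
      apply Rlt_le. exact (proj1 (HS (mkposreal eps Heps)) k).
    - exfalso. specialize (HS (sum_Z (inv_sq_ext w)
        (Zfloor (log2 (r 1%nat))) (Z.of_nat 1)) 0%nat).
      exact (Rlt_irrefl _ HS). }
  destruct Hsup as [M HM].
  exists (4 * sqrt (exp M)). intros a a_sum.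
  set (x := fun k : nat => Cmod (a k) ^ 2 * w k ^ 2) in *.
  assert (Hx : forall k, 0 <= x k)
    by (intros k; apply Rmult_le_pos; apply pow2_ge_0).
  assert (Hgap : forall n : Z,
    ~ (exists k : nat, 2 ^ k - r k <= IZR n <= 2 ^ k + r k) ->
    (forall k, n <> (2 ^ Z.of_nat k)%Z) /\ ~ below_pow2 r n).
  { intros n Hn. split.
    - intros k ->. apply Hn. exists k. rewrite IZR_pow2. destruct (Hb k). lra.
    - intros (k & H1 & _ & H2). apply Hn. exists k. split; [exact H1|].
      apply IZR_lt in H2. rewrite IZR_pow2 in H2. destruct (Hb k). lra. }
  assert (HS0 : 0 <= Series x) by exact (psum_le_Series x 0 Hx a_sum).
  destruct HS0 as [HS0|HS0].
  - destruct (geometric_cutoffs x Hx a_sum HS0) as (N & HN0 & HN & Htail).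
    set (b := fun l k : nat => if andb (Nat.leb (N l) k) (Nat.ltb k (N (S l)))
      then a k else RtoC 0).
    destruct (functional_choice (fun (l : nat) (g : R -> C) =>
      C_circle g /\ (forall k, fourier_coeff g (2 ^ Z.of_nat k)%Z = b l k) /\
      (forall m, (forall k, m <> (2 ^ Z.of_nat k)%Z) -> ~ below_pow2 r m ->
        fourier_coeff g m = RtoC 0) /\
      forall t, Cmod (g t) <= 2 * sqrt (Series x * (1 / 4) ^ l * exp M))) as [g Hg].
    { intros l. apply (extension_finite r w M _ (b l) (N (S l))); auto.
      - intros k Hk. unfold b.
        destruct (Nat.ltb_spec k (N (S l))); [lia|].
        now rewrite Bool.andb_false_r.
      - apply Rmult_lt_0_compat; [exact HS0|apply pow_lt; lra].
      - eapply Rle_trans; [|apply (Htail l)].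
        apply Rle_trans with (psum x (N (S l)) - psum x (N l)).
        + rewrite <- psum_split by (specialize (HN l); lia).
          apply psum_le. intros k Hk. unfold b. apply Nat.ltb_lt in Hk as ->.
          destruct (Nat.leb (N l) k); simpl andb; cbv iota; [apply Rle_refl|].
          rewrite Cmod_0. lra.
        + assert (H := psum_le_Series x (N (S l)) Hx a_sum). lra. }
    (* The factor [2] comes from the two parities; summing the geometric series
       doubles it to the [4] of the final constant. *)
    destruct (uniform_geometric_sum g (2 * (sqrt (Series x) * sqrt (exp M))))
      as (f & Hf1 & Hf2 & Hf3).
    + intros l. apply Hg.
    + intros l t. destruct (Hg l) as (_ & _ & _ & H).
      eapply Rle_trans; [apply H|]. apply Req_le.
      assert (He := exp_pos M).
      assert (Hq : 0 < (1 / 2) ^ l) by (apply pow_lt; lra).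
      replace ((1 / 4) ^ l) with ((1 / 2) ^ l * (1 / 2) ^ l)
        by (rewrite <- Rpow_mult_distr; f_equal; field).
      rewrite sqrt_mult, sqrt_mult, sqrt_square by nra. ring.
    + exists f. split; [exact Hf1|split; [|split]].
      * intros k. apply Hf3. exists (S k). intros L HL.
        rewrite (psum_ext _ (fun l => b l k)) by (intros; apply Hg).
        apply psum_slices; auto.
        assert (Hid : forall l, (l <= N l)%nat)
          by (induction l as [|l IH]; [lia|specialize (HN l); lia]).
        specialize (Hid L). lia.
      * intros n Hn. destruct (Hgap n Hn) as [Hn1 Hn2]. apply Hf3. exists 0%nat.
        intros L _. rewrite psum_zero; [reflexivity|].
        intros l _. now apply Hg.
      * apply sup_norm_le. intros t. eapply Rle_trans; [apply Hf2|].
        apply Req_le. ring.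
  - assert (Ha : forall k, a k = RtoC 0).
    { intros k. assert (H := psum_le_Series x (S k) Hx a_sum).
      assert (H' := psum_pos x k Hx).
      rewrite psum_S in H. change (psum x k + x k <= Series x) in H.
      assert (Hk : Cmod (a k) ^ 2 * w k ^ 2 = 0)
        by (specialize (Hx k); unfold x in Hx at 1; unfold x at 2 in H; lra).
      apply Cmod_eq_0. destruct (Rmult_integral _ _ Hk) as [H1|H1].
      - now apply (Rsqr_0_uniq), (eq_trans (Rsqr_pow2 _)).
      - exfalso. assert (H2 : 0 < w k ^ 2) by now apply pow_lt. lra. }
    assert (Hf : trig (fun _ => False) (fun _ => RtoC 0)) by now apply trig_zero.
    exists (fun _ => RtoC 0). split; [exact (trig_C_circle _ _ Hf)|split; [|split]].
    + intros k. rewrite Ha. now apply (trig_fourier_coeff (fun _ => False)).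
    + intros n _. now apply (trig_fourier_coeff (fun _ => False)).
    + apply sup_norm_le. intros t. rewrite Cmod_0, <- HS0, sqrt_0. lra.
Qed.
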